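(* Let $N\ge3$ be an odd integer and let $z\in\mathbb{C}$ with $z\ne\pm2$. Then $K_N(\Sigma_{0,2})_z$, equipped with the normalized trace $Tr_z$, is a Frobenius algebra over $\mathbb{C}$.
   Context: Let $A=e^{\pi i/N}$. The Tchebychev polynomials are $T_0(x)=2$, $T_1(x)=x$, $T_{n+1}(x)=xT_n(x)-T_{n-1}(x)$. The Kauffman bracket skein algebra $K_N(\Sigma_{0,2})$ of the annulus $\Sigma_{0,2}$ (framed links in $\Sigma_{0,2}\times[0,1]$ modulo the Kauffman bracket skein relations with parameter $A$, with stacking product) is isomorphic to $\mathbb{C}[x]$, where $x$ is the core of the annulus with the blackboard framing. The subalgebra $\chi(\Sigma_{0,2})\subset K_N(\Sigma_{0,2})$ is the image of the threading map (threading every component of a framed link with $T_N$); it is the complex span of $\{T_{Na}(x): a\ge0\}$, i.e. the polynomial ring $\mathbb{C}[T_N(x)]$. A place is a ring homomorphism ($\mathbb{C}$-algebra homomorphism) $\phi:\chi(\Sigma_{0,2})\to\mathbb{C}$; it is determined by $z=\phi(T_N(x))\in\mathbb{C}$. For this $\phi$, $K_N(\Sigma_{0,2})_z=K_N(\Sigma_{0,2})/I_\phi$ where $I_\phi=(\ker\phi)K_N(\Sigma_{0,2})$. It is a finite dimensional complex algebra, and $Tr_z:K_N(\Sigma_{0,2})_z\to\mathbb{C}$ sends an element to the trace of left multiplication by it, normalized so that $Tr_z(1)=1$. A Frobenius algebra over a field $k$ is a finite dimensional $k$-algebra $B$ equipped with a $k$-linear functional $\epsilon:B\to k$ having no nontrivial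 principal ideals in its kernel; equivalently, for every $a\ne0$ in $B$ there is $b\in B$ with $\epsilon(ab)\neq0$. *)

(* Defs.v *)
From HB Require Import structures.
From mathcomp Require Import all_boot all_order all_algebra all_field.
From mathcomp Require Import ring_quotient complex.
From mathcomp Require Import boolp reals.

Set Implicit Arguments.
Unset Strict Implicit.
Unset Printing Implicit Defensive.

Import GRing.Theory passmx.
Local Open Scope ring_scope.
Local Open Scope quotient_scope.

(** ** Frobenius algebras and the normalized trace *)

Definition frobenius_algebra (k : fieldType) (B : falgType k)
    (eps : {linear B -> k^o}) : Prop :=
  forall a : B, a != 0 -> exists b : B, eps (a * b) != 0.

Section NormalizedTrace.
Variables (k : fieldType) (B : falgType k).

(* [falgType] requires finite dimension; the trace is independent of the basis,
   and [vbasis] is the one supplied by the library. *)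
Definition ntrace (a : B) : k^o :=
  \tr (mxof (vbasis {:B}) (vbasis {:B}) (amull a)) / (\dim {:B})%:R.

Lemma ntrace_linear : linear ntrace.
Proof.
move=> c u v; by rewrite /ntrace !linearP /= mulrDl -mulrA.
Qed.

HB.instance Definition _ := GRing.isLinear.Build k B k^o _ ntrace ntrace_linear.

Lemma ntrace1 : (\dim {:B})%:R != 0 :> k -> ntrace 1 = 1.
Proof.
move=> dB; rewrite /ntrace amull1 mxof1 ?mxtrace1 ?divff //.
exact: basis_free (vbasisP _).
Qed.

End NormalizedTrace.

(** ** The skein algebra of the annulus *)

Section Annulus.
Variable R : realType.
Local Notation C := R[i].

(* The Kauffman bracket skein algebra of the annulus, identified with C[x]:
   ['X] is the core and ['X^k] is the framed link made of k parallel cores.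
   The parameter A = exp(i pi / N) does not affect the algebra C[x]; N enters
   through the threading map below. *)
Local Notation skein_annulus := {poly C}.

Fixpoint tcheb (n : nat) : skein_annulus :=
  match n with
  | 0 => 2%:R
  | n'.+1 => match n' with
             | 0 => 'X
             | m.+1 => 'X * tcheb n' - tcheb m
             end
  end.

Lemma tcheb0 : tcheb 0 = 2%:R. Proof. by []. Qed.

Lemma tcheb1 : tcheb 1 = 'X. Proof. by []. Qed.

Lemma tchebS n :
  tcheb n.+2 = 'X * tcheb n.+1 - tcheb n.
Proof. by []. Qed.

Lemma size_tcheb n : (0 < n)%N -> size (tcheb n) = n.+1.
Proof.
suff H m : size (tcheb m.+1) = m.+2 /\
           (size (tcheb m) <= m.+1)%N.
  by case: n => // n _; case: (H n).
elim: m => [|m [IH1 IH2]].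
  rewrite tcheb1 size_polyX tcheb0; split=> //.
  by rewrite -polyC_natr size_polyC leq_b1.
rewrite IH1; split=> //.
have e : size ('X * tcheb m.+1) = m.+3.
  by rewrite mulrC size_mulX ?IH1 // -size_poly_eq0 IH1.
rewrite tchebS size_polyDl e // size_polyN.
exact: leq_trans IH2 _.
Qed.

Variable N : nat.

(* Threading k parallel cores with T_N gives [T_N(x)^k], so on C[x] the
   threading map is substitution of T_N(x) for x. *)
Definition threading (p : skein_annulus) : skein_annulus := p \Po tcheb N.

Definition in_chi : pred skein_annulus :=
  fun p => `[< exists q, p = threading q >].

Lemma in_chiP p : reflect (exists q, p = threading q) (p \in in_chi).
Proof. exact: asboolP. Qed.

Lemma in_chi_subalg : subalg_closed in_chi.
Proof.
split; first by apply/in_chiP; exists 1; rewrite /threading comp_polyC.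
- move=> a u v /in_chiP[p ->] /in_chiP[q ->]; apply/in_chiP.
  by exists (a *: p + q); rewrite /threading comp_polyD comp_polyZ.
- move=> u v /in_chiP[p ->] /in_chiP[q ->]; apply/in_chiP.
  by exists (p * q); rewrite /threading comp_polyM.
Qed.

HB.instance Definition _ :=
  GRing.isSubalgClosed.Build C skein_annulus in_chi in_chi_subalg.

Record chi : Type := Chi { chi_val :> skein_annulus; _ : chi_val \in in_chi }.
HB.instance Definition _ := [isSub for chi_val].
HB.instance Definition _ := [Choice of chi by <:].
HB.instance Definition _ :=
  [SubChoice_isSubAlgebra of chi by <:].
HB.instance Definition _ := [SubNzRing_isSubComNzRing of chi by <:].

Lemma threading_in_chi p : threading p \in in_chi.
Proof. by apply/in_chiP; exists p. Qed.

Definition chi_threading p : chi := Chi (threading_in_chi p).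

(* T_N(x) as an element of chi. *)
Definition chi_tcheb : chi := chi_threading 'X.

Lemma val_chi_tcheb : chi_val chi_tcheb = tcheb N.
Proof. exact: comp_polyX. Qed.

Definition place : Type := {lrmorphism chi -> C^o}.

Lemma place_threading (phi : place) p :
  phi (chi_threading p) = p.[phi chi_tcheb].
Proof.
elim/poly_ind: p => [|p c IH].
  rewrite horner0 -[RHS](rmorph0 phi); congr (phi _).
  by apply: val_inj; rewrite /= /threading comp_poly0.
have -> : chi_threading (p * 'X + c%:P) =
          chi_threading p * chi_tcheb + c *: 1.
  apply: val_inj; rewrite /= /threading comp_polyD comp_polyM comp_polyX.
  by rewrite comp_polyC alg_polyC.
rewrite hornerMXaddC; apply: etrans (rmorphD phi _ _) _.
congr (_ + _); first by apply: etrans (rmorphM phi _ _) _; congr (_ * _).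
by apply: etrans (linearZ_LR phi c 1) _; rewrite rmorph1; exact: mulr1.
Qed.

Lemma chi_threadingP (u : chi) : exists p, u = chi_threading p.
Proof. by case: u => u Hu; case/in_chiP: (Hu) => p e; exists p; apply: val_inj. Qed.

Section Quotient.
Variable phi : place.

(* The ideal (ker phi) C[x] of the whole skein algebra. *)
Definition in_ker_ideal : pred skein_annulus := fun p =>
  `[< exists (n : nat) (u : 'I_n -> chi) (q : 'I_n -> skein_annulus),
        (forall i, phi (u i) = 0) /\ p = \sum_(i < n) chi_val (u i) * q i >].

Lemma in_ker_idealE p :
  (p \in in_ker_ideal) = (tcheb N - (phi chi_tcheb)%:P %| p).
Proof.
set z := phi chi_tcheb; apply/asboolP/idP => [[n [u [q [hu ->]]]]|].
  apply: (big_ind (fun x => _ %| x)) => [|a b|i _]; [exact: dvdp0 | exact: dvdp_add |].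
  apply: dvdp_mulr; have [r er] := chi_threadingP (u i).
  have /eqP : phi (u i) = 0 := hu i.
  rewrite er place_threading -/z => /factor_theorem[s ->].
  rewrite /= /threading comp_polyM comp_polyB comp_polyX comp_polyC.
  exact: dvdp_mull.
case/dvdpP => q ->; exists 1%N, (fun=> chi_threading ('X - z%:P)), (fun=> q).
split=> [_|].
  apply: etrans (place_threading phi _) _.
  by rewrite -/z hornerXsubC subrr.
by rewrite big_ord1 /= /threading comp_polyB comp_polyX comp_polyC mulrC.
Qed.

Lemma size_tcheb_subC (z : C) :
  (0 < N)%N -> size (tcheb N - z%:P) = N.+1.
Proof.
move=> N_gt0; rewrite size_polyDl size_tcheb // size_polyN size_polyC.
by case: (z != 0).
Qed.

Lemma in_ker_ideal_idealr : idealr_closed in_ker_ideal.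
Proof.
split; first by rewrite in_ker_idealE dvdp0.
- rewrite in_ker_idealE dvdp1; have [N0|N_gt0] := posnP N; last first.
    by rewrite size_tcheb_subC // eqSS -lt0n.
  have -> : chi_tcheb = chi_threading 2%:R%:P.
    apply: val_inj; apply: etrans val_chi_tcheb _.
    rewrite /= /threading comp_polyC.
    by rewrite N0 tcheb0 polyC_natr.
  rewrite place_threading hornerC N0 tcheb0 polyC_natr subrr.
  by rewrite size_poly0.
- move=> a u v; rewrite !in_ker_idealE => hu hv.
  by apply: dvdp_add => //; apply: dvdp_mull.
Qed.

HB.instance Definition _ :=
  isIdealr.Build skein_annulus in_ker_ideal in_ker_ideal_idealr.

Definition ker_ideal : idealr skein_annulus := in_ker_ideal.

(* For N = 0 the quotient is infinite dimensional, so the hypothesis on N is a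
   parameter of the type that carries the [falgType] structure. *)
Definition skein_quot (hN : (3 <= N)%N) : Type := {ideal_quot ker_ideal}.

Section Structures.
Hypothesis hN : (3 <= N)%N.
Local Notation K := (skein_quot hN).

HB.instance Definition _ := GRing.ComNzRing.copy K {ideal_quot ker_ideal}.

Definition skein_proj (p : skein_annulus) : K := \pi_{ideal_quot ker_ideal} p.

Lemma skein_projP p q :
  reflect (skein_proj p = skein_proj q) (p - q \in in_ker_ideal).
Proof. by rewrite (Quotient.idealrBE ker_ideal); apply: eqP. Qed.

Lemma skein_proj_surj (a : K) : exists p, a = skein_proj p.
Proof. by exists (repr (a : {ideal_quot ker_ideal})); rewrite /skein_proj reprK. Qed.

Lemma skein_projB : {morph skein_proj : p q / p - q}.
Proof. exact: (rmorphB (\pi_{ideal_quot ker_ideal})). Qed.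
Lemma skein_projD : {morph skein_proj : p q / p + q}.
Proof. exact: (rmorphD (\pi_{ideal_quot ker_ideal})). Qed.
Lemma skein_projM : {morph skein_proj : p q / p * q}.
Proof. exact: (rmorphM (\pi_{ideal_quot ker_ideal})). Qed.
Lemma skein_proj1 : skein_proj 1 = 1.
Proof. exact: (rmorph1 (\pi_{ideal_quot ker_ideal})). Qed.

Definition skein_quot_scale (c : C) (a : K) : K := skein_proj c%:P * a.

Lemma skein_quot_scaleA c d a :
  skein_quot_scale c (skein_quot_scale d a) = skein_quot_scale (c * d) a.
Proof. by rewrite /skein_quot_scale mulrA -skein_projM -polyCM. Qed.
Lemma skein_quot_scale1 : left_id 1 skein_quot_scale.
Proof. by move=> a; rewrite /skein_quot_scale skein_proj1 mul1r. Qed.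
Lemma skein_quot_scaleDr : right_distributive skein_quot_scale +%R.
Proof. by move=> c a b; rewrite /skein_quot_scale mulrDr. Qed.
Lemma skein_quot_scaleDl a : {morph skein_quot_scale^~ a : c d / c + d}.
Proof.
by move=> c d; rewrite /skein_quot_scale polyCD skein_projD mulrDl.
Qed.

HB.instance Definition _ := GRing.Zmodule_isLmodule.Build C K
  skein_quot_scaleA skein_quot_scale1 skein_quot_scaleDr skein_quot_scaleDl.

Lemma skein_projZ c p : skein_proj (c *: p) = c *: skein_proj p.
Proof. by rewrite -mul_polyC skein_projM. Qed.

Lemma skein_quot_scaleAl (c : C) (a b : K) : c *: (a * b) = (c *: a) * b.
Proof. exact: mulrA. Qed.
HB.instance Definition _ :=
  GRing.Lmodule_isLalgebra.Build C K skein_quot_scaleAl.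
HB.instance Definition _ := GRing.Lalgebra_isComAlgebra.Build C K.

Local Notation M := (tcheb N - (phi chi_tcheb)%:P).

Definition skein_coord (a : K) : 'rV[C]_N :=
  poly_rV (repr (a : {ideal_quot ker_ideal}) %% M).

Lemma skein_coord_proj p : skein_coord (skein_proj p) = poly_rV (p %% M).
Proof.
rewrite /skein_coord; congr poly_rV; apply/eqP; rewrite -subr_eq0.
rewrite -modpN -modpD; apply/eqP/modp_eq0; rewrite -in_ker_idealE.
by apply/skein_projP; rewrite /skein_proj reprK.
Qed.

Lemma size_modM p : (size (p %% M)%R <= N)%N.
Proof.
have N_gt0 : (0 < N)%N by apply: leq_trans hN.
by rewrite -ltnS -(size_tcheb_subC (phi chi_tcheb) N_gt0) ltn_modp
           -size_poly_eq0 size_tcheb_subC.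
Qed.

Lemma skein_quot_vect : Vector.axiom N K.
Proof.
exists skein_coord.
  move=> c a b; have [p ->] := skein_proj_surj a.
  have [q ->] := skein_proj_surj b.
  rewrite -skein_projZ -skein_projD !skein_coord_proj modpD modpZl.
  by rewrite linearD linearZ.
exists (fun v => skein_proj (rVpoly v)) => [a|v]; last first.
  rewrite skein_coord_proj modp_small ?rVpolyK //.
  rewrite size_tcheb_subC ?(leq_trans _ hN) // ltnS; exact: size_poly.
have [p ->] := skein_proj_surj a.
rewrite skein_coord_proj poly_rV_K ?size_modM //; apply/skein_projP.
rewrite in_ker_idealE {2}(divp_eq p M) opprD addrCA subrr addr0.
by rewrite dvdpNr dvdp_mull.
Qed.
HB.instance Definition _ := Lmodule_hasFinDim.Build C K skein_quot_vect.
HB.instance Definition _ := Algebra_isFalgebra.Build C K.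

End Structures.
End Quotient.

Lemma place_ext (phi psi : place) :
  phi chi_tcheb = psi chi_tcheb -> phi =1 psi.
Proof.
move=> e u; have [p ->] := chi_threadingP u.
apply: etrans (place_threading phi p) _.
by rewrite e; exact/esym/place_threading.
Qed.

Lemma place_exists (z : C) : (3 <= N)%N -> exists phi : place, phi chi_tcheb = z.
Proof.
move=> hN; have /closed_rootP[x /rootP hx] : size (tcheb N - z%:P) != 1.
  by rewrite size_tcheb_subC ?(leq_trans _ hN) // eqSS -lt0n (leq_trans _ hN).
pose f (u : chi) : C^o := (chi_val u).[x].
have fD : linear f by move=> c u v; rewrite /f /= hornerD hornerZ.
have fM : monoid_morphism f.
  by split=> [|u v]; rewrite /f /= ?hornerC ?hornerM.
pose fl := GRing.isLinear.Build C chi C^o _ f fD.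
pose fm := GRing.isMonoidMorphism.Build chi C^o f fM.
pose phi : place := HB.pack f fl fm.
exists phi; rewrite /= /f val_chi_tcheb.
by move/eqP: hx; rewrite hornerD hornerN hornerC subr_eq0 => /eqP.
Qed.

End Annulus.

(* Main.v *)
(* Write M = T_N(x) - z. The Pell identity T_n^2 - 4 = (x^2 - 4) S_n^2 together
   with T_n' = n S_n (S_n = tcheb2 n being the Tchebychev polynomial of the
   second kind of degree n - 1) shows that T_n^2 = 4 wherever T_n' vanishes, so
   M is separable when z <> 2, -2. Hence a class [p] <> 0 in C[x]/(M) satisfies
   p(r) <> 0 for some root r of M. With g = M/(x - r) we have
   q g = q(r) g mod M for all q, so multiplication by g has rank one and trace
   g(r) <> 0, and Tr([p][g]) = p(r) Tr([g]) <> 0. *)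
Require Import Defs.
From mathcomp Require Import all_boot all_order all_algebra all_field.
From mathcomp Require Import ring_quotient complex.
From mathcomp Require Import boolp reals.
From mathcomp Require Import ring.
Import GRing.Theory Num.Theory passmx.
Local Open Scope ring_scope.

(* When [a] is nonzero, [chi] is linear and multiplication by [a] is the rank-one
   map [b |-> chi b *: a], whose trace is [chi a]. Writing [chi a *: a] as
   [a * a] lets the statement cover [a = 0] and arbitrary functions [chi]. *)
Lemma trace_amull (k : fieldType) (B : falgType k) (a : B) (chi : B -> k) :
  (forall b, a * b = chi b *: a) ->
  \tr (mxof (vbasis {:B}) (vbasis {:B}) (amull a)) *: a = a * a.
Proof.
move=> aE.
rewrite [X in _ = a * X](coord_vbasis (memvf a)) mulr_sumr scaler_suml.
apply: eq_bigr => i _; rewrite -scalerAr aE scalerA; congr (_ *: _).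
set e := vbasis _; set f := amull a.
have fE b : f b = a * b by rewrite lfunE.
have -> : mxof e e f i i = rVof e (f e`_i) 0 i.
  by rewrite (rVof_app e (vbasisP _)) rVofE ?vbasisP // -rowE [RHS]mxE.
by rewrite -coord_rVof fE aE linearZ /= mulrC.
Qed.

(** A zero trace would force [a * a = 0], and the dimension is invertible in characteristic 0. *)
Lemma ntrace_neq0 (R : numFieldType) (B : falgType R) (a : B) (chi : B -> R) :
  (forall b, a * b = chi b *: a) -> a * a != 0 -> ntrace a != 0.
Proof.
move=> aE aa0; apply: mulf_neq0.
  by apply: contraNneq aa0 => tr0; rewrite -(trace_amull _ _ _ _ aE) tr0 scale0r.
by rewrite invr_eq0 pnatr_eq0 -lt0n (adim_gt0 {:B}).
Qed.

(* Second kind, shifted so that [tcheb2 R 0 = 0] and [tcheb2 R n.+1] has degree n. *)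
Fixpoint tcheb2 (R : comNzRingType) (n : nat) : {poly R} :=
  match n with
  | 0 => 0
  | n'.+1 => match n' with
             | 0 => 1
             | m.+1 => 'X * tcheb2 R n' - tcheb2 R m
             end
  end.

Section Tchebychev.
Variable R : realType.
Local Notation S := (tcheb2 R[i]).
Local Notation T := (tcheb R).

Lemma tcheb2S n : S n.+2 = 'X * S n.+1 - S n. Proof. by []. Qed.

Lemma tchebE n : T n = 2%:R * S n.+1 - 'X * S n.
Proof.
suff [] : T n = 2%:R * S n.+1 - 'X * S n /\
          T n.+1 = 2%:R * S n.+2 - 'X * S n.+1 by [].
elim: n => [|n [IH1 IH2]].
  by split; [rewrite tcheb0|rewrite tcheb1]; rewrite /=; ring.
by split=> //; rewrite tchebS IH2 IH1 !tcheb2S; ring.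
Qed.

(** The form a^2 - X a b + b^2 is invariant under the recurrence step (a, b) -> (X a - b, a). *)
Lemma tcheb2_norm n : S n.+1 ^+ 2 - 'X * S n.+1 * S n + S n ^+ 2 = 1.
Proof.
elim: n => [|n IH]; first by rewrite /=; ring.
by rewrite tcheb2S -[RHS]IH; ring.
Qed.

Lemma tcheb_pell n : T n ^+ 2 - 4%:R = ('X ^+ 2 - 4%:R) * S n ^+ 2.
Proof.
(* Multiplying 4 by this form makes both sides quadratic in [S n.+1] and [S n]. *)
have -> : T n ^+ 2 - 4%:R =
    T n ^+ 2 - 4%:R * (S n.+1 ^+ 2 - 'X * S n.+1 * S n + S n ^+ 2).
  by rewrite tcheb2_norm mulr1.
by rewrite tchebE; ring.
Qed.

Lemma deriv_tcheb n : (T n)^`() = n%:R * S n.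
Proof.
suff [] : (T n)^`() = n%:R * S n /\ (T n.+1)^`() = n.+1%:R * S n.+1 by [].
elim: n => [|n [IH1 IH2]].
  split; first by rewrite tcheb0 -polyC_natr derivC mul0r.
  by rewrite tcheb1 derivX mulr1.
split=> //; rewrite tchebS derivB derivM derivX mul1r IH1 IH2 tchebE !tcheb2S.
by rewrite -!natr1; ring.
Qed.

End Tchebychev.

Lemma separable_tcheb_subC (R : realType) (N : nat) (z : R[i]) :
  (0 < N)%N -> z != 2%:R -> z != - 2%:R -> separable_poly (tcheb R N - z%:P).
Proof.
move=> N_gt0 hz hz'; rewrite unlock; apply: Pdiv.ClosedField.root_coprimep => x.
rewrite /root !hornerE subr_eq0 => /eqP Tx.
rewrite derivB derivC subr0 deriv_tcheb; apply: contraNneq hz => S0.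
(* At a common root [x] the Pell identity reads z^2 = 4. *)
have /eqP := congr1 (horner^~ x) (tcheb_pell R N).
move: S0; rewrite -polyC_natr hornerM hornerC => /eqP.
rewrite mulf_eq0 pnatr_eq0 eqn0Ngt N_gt0 /= => /eqP S0.
rewrite -polyC_natr [X in _ == X]hornerM horner_exp S0 expr0n mulr0.
rewrite hornerD hornerN hornerC horner_exp Tx subr_eq0.
have -> : 4%:R = 2%:R ^+ 2 :> R[i] by ring.
by rewrite eqf_sqr (negPf hz') orbF.
Qed.

(** Up to a scalar [m] is a product of distinct linear factors, so it divides any [p] vanishing at
    all its roots. *)
Lemma separable_dvdp_root (F : closedFieldType) (m p : {poly F}) :
  separable_poly m -> ~~ (m %| p) -> exists2 r, root m r & ~~ root p r.
Proof.
have [rs ->] := closed_field_poly_normal m; set c := lead_coef m.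
have [->|c0] := eqVneq c 0; first by rewrite scale0r => /separable_poly_neq0/eqP.
have mE := eqp_scale (\prod_(x <- rs) ('X - x%:P)) c0.
rewrite (eqp_separable mE) separable_prod_XsubC (eqp_dvdl _ mE) => Urs.
move=> ndvd; have /allPn[r rs_r pr] : ~~ all (root p) rs.
  apply: contra ndvd => rs_p.
  by apply: uniq_roots_dvdp; rewrite ?uniq_rootsE.
by exists r; rewrite // rootZ // root_prod_XsubC.
Qed.

Theorem theorem3p10 (R : realType) (N : nat) (hN : (3 <= N)%N) (oddN : odd N)
    (z : R[i]) (hz : z != 2%:R) (hz' : z != - 2%:R)
    (phi : place R N) (hphi : phi (chi_tcheb R N) = z) :
  frobenius_algebra (@ntrace R[i] (skein_quot phi hN)).
Proof.
set m := tcheb R N - z%:P.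
have proj0 q : (skein_proj phi hN q == 0) = (m %| q).
  rewrite /m -hphi -in_ker_idealE -{2}[q]subr0.
  have <- : skein_proj phi hN 0 = 0 by rewrite -(subrr 0) skein_projB subrr.
  by apply/eqP/skein_projP.
have sep_m : separable_poly m.
  by apply: separable_tcheb_subC => //; exact: (ltn_trans _ hN).
move=> a; have [p ->] := skein_proj_surj a; rewrite proj0.
move=> /(separable_dvdp_root _ _ _ sep_m)[r mr pr].
have [g mE] := factor_theorem _ _ mr.
(* Separability makes [r] a simple root of [m]. *)
have gr : g.[r] != 0 by move: sep_m; rewrite mE separable_root => /andP[].
pose b := skein_proj phi hN g.
have projb q : skein_proj phi hN q * b = q.[r] *: b.
  apply/eqP; rewrite -subr_eq0 -skein_projM -skein_projZ -skein_projB proj0.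
  (* Cancelling [g] leaves X - r dividing q - q(r). *)
  rewrite -mul_polyC -mulrBl mulrC mE dvdp_mul2l.
    by rewrite dvdp_XsubCl /root !hornerE subrr.
  by apply: contraNneq gr => ->; rewrite horner0.
have bb : b * b != 0.
  rewrite -skein_projM proj0; apply: contra gr => m_gg.
  by have := root_dvdp m_gg mr; rewrite /root hornerM mulf_eq0 orbb.
(* [chi] is evaluation at [r]; choice avoids checking that it descends to classes. *)
have /choice[chi chiE] : forall c, exists x, b * c = x *: b.
  move=> c; have [q ->] := skein_proj_surj c.
  by exists q.[r]; rewrite mulrC projb.
exists b; rewrite projb linearZ mulf_neq0 //; exact: ntrace_neq0 chiE bb.
Qed.
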